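(* Let $p,q\ge0$ be integers with $p\le q+1$, let $\widehat{a}_1,\dots,\widehat{a}_p,\widehat{b}_1,\dots,\widehat{b}_q$ be dual numbers with no $\Re(\widehat{b}_j)$ in $\{0,-1,-2,\dots\}$, and let $\widehat{x}$ be a dual variable, with $|\widehat{x}|<1$ if $p=q+1$. Let $\widehat{\theta}=\widehat{x}\,\frac{d}{d\widehat{x}}$. Then the dual generalized hypergeometric function satisfies $$\Bigl[\widehat{\theta}(\widehat{\theta}+\widehat{b}_1-1)\cdots(\widehat{\theta}+\widehat{b}_q-1)-\widehat{x}\,(\widehat{\theta}+\widehat{a}_1)\cdots(\widehat{\theta}+\widehat{a}_p)\Bigr]\,{}_pF_q(\widehat{a}_1,\dots,\widehat{a}_p;\widehat{b}_1,\dots,\widehat{b}_q;\widehat{x})=0.$$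
   Context: Dual numbers are $\widehat{x}=x_1+\varepsilon x_2$, $x_1,x_2\in\mathbb{R}$, $\varepsilon^2=0$, forming the commutative ring $\mathbb{R}[\varepsilon]/(\varepsilon^2)$; $\Re(\widehat{x})=x_1$ and $|\widehat{x}|=|x_1|$. The dual shifted factorial is $(\widehat{a})_0=1$, $(\widehat{a})_k=\widehat{a}(\widehat{a}+1)\cdots(\widehat{a}+k-1)$ for $k\ge1$, and $${}_pF_q(\widehat{a}_1,\dots,\widehat{a}_p;\widehat{b}_1,\dots,\widehat{b}_q;\widehat{x})=\sum_{k=0}^\infty\frac{(\widehat{a}_1)_k\cdots(\widehat{a}_p)_k}{(\widehat{b}_1)_k\cdots(\widehat{b}_q)_k}\,\frac{(\widehat{x})^k}{k!},$$ convergence being in real and dual parts. The dual derivative $\frac{d}{d\widehat{x}}$ of a dual valued function of $\widehat{x}=x_1+\varepsilon x_2$ is $\frac{\partial}{\partial x_1}$ applied to its real and dual parts (so $\frac{d}{d\widehat{x}}(\widehat{x})^k=k(\widehat{x})^{k-1}$); dual constants and $\widehat{x}$ act by multiplication. *)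

(* Defs.v *)
From HB Require Import structures.
From mathcomp Require Import all_boot all_order all_algebra.
From mathcomp Require Import all_classical all_reals all_analysis.

Set Implicit Arguments.
Unset Strict Implicit.
Unset Printing Implicit Defensive.

Import Order.TTheory GRing.Theory Num.Theory.
Import numFieldNormedType.Exports.

Local Open Scope classical_set_scope.
Local Open Scope ring_scope.

(* [DualNum x1 x2] is the dual number x1 + eps x2. *)
Record dualnum (R : Type) := DualNum { rpart : R; dpart : R }.

Definition pair_of_dualnum (R : Type) (x : dualnum R) : R * R :=
  (rpart x, dpart x).

Definition dualnum_of_pair (R : Type) (x : R * R) : dualnum R :=
  DualNum x.1 x.2.

Lemma pair_of_dualnumK (R : Type) :
  cancel (@pair_of_dualnum R) (@dualnum_of_pair R).
Proof. by case. Qed.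

HB.instance Definition _ (R : choiceType) :=
  Choice.copy (dualnum R) (can_type (@pair_of_dualnumK R)).

Section DualRing.
Variable R : comNzRingType.
Implicit Types x y z : dualnum R.

Definition dual0 : dualnum R := DualNum 0 0.
Definition dual1 : dualnum R := DualNum 1 0.
Definition dual_opp x : dualnum R := DualNum (- rpart x) (- dpart x).
Definition dual_add x y : dualnum R :=
  DualNum (rpart x + rpart y) (dpart x + dpart y).
Definition dual_mul x y : dualnum R :=
  DualNum (rpart x * rpart y) (rpart x * dpart y + dpart x * rpart y).

Fact dual_addA : associative dual_add.
Proof. by move=> x y z; rewrite /dual_add /= !addrA. Qed.

Fact dual_addC : commutative dual_add.
Proof.
by move=> x y; rewrite /dual_add addrC [dpart x + _]addrC.
Qed.

Fact dual_add0 : left_id dual0 dual_add.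
Proof. by case=> x1 x2; rewrite /dual_add /= !add0r. Qed.

Fact dual_addN : left_inverse dual0 dual_opp dual_add.
Proof. by move=> x; rewrite /dual_add /= !addNr. Qed.

HB.instance Definition _ := GRing.isZmodule.Build (dualnum R)
  dual_addA dual_addC dual_add0 dual_addN.

Fact dual_mulA : associative dual_mul.
Proof.
by move=> x y z; rewrite /dual_mul /= mulrDr mulrDl !mulrA addrA.
Qed.

Fact dual_mulC : commutative dual_mul.
Proof.
move=> x y; rewrite /dual_mul mulrC addrC.
by rewrite [dpart x * _]mulrC [rpart x * _]mulrC.
Qed.

Fact dual_mul1 : left_id dual1 dual_mul.
Proof. by case=> x1 x2; rewrite /dual_mul /= !mul1r mul0r addr0. Qed.

Fact dual_mulD : left_distributive dual_mul dual_add.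
Proof.
by move=> x y z; rewrite /dual_mul /dual_add /= !mulrDl addrACA.
Qed.

Fact dual_1neq0 : dual1 != dual0.
Proof. by apply/eqP=> -[] /eqP; rewrite oner_eq0. Qed.

HB.instance Definition _ := GRing.Zmodule_isComNzRing.Build (dualnum R)
  dual_mulA dual_mulC dual_mul1 dual_mulD dual_1neq0.

Lemma dual_eps_sq : (DualNum 0 1 : dualnum R) ^+ 2 = 0.
Proof.
by rewrite expr2 -[LHS]/(dual_mul _ _) /dual_mul /= !mulr0 mul0r addr0.
Qed.

End DualRing.

Section DualUnitRing.
Variable R : fieldType.
Implicit Types x y : dualnum R.

Definition dual_unit : {pred dualnum R} := fun x => rpart x != 0.

(* (x1 + eps x2)^-1 = x1^-1 - eps x2 / x1^2; as for every [unitRingType], the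
   inverse of a non-unit is the non-unit itself. *)
Definition dual_inv x : dualnum R :=
  if rpart x == 0 then x
  else DualNum (rpart x)^-1 (- (dpart x / rpart x ^+ 2)).

Fact dual_mulV : {in dual_unit, left_inverse 1 dual_inv *%R}.
Proof.
move=> x; rewrite unfold_in /dual_inv => x0; rewrite (negbTE x0).
rewrite -[LHS]/(dual_mul _ _) /dual_mul /= mulVf // expr2 invfM mulNr -!mulrA.
by rewrite mulVf // mulr1 [_^-1 * _]mulrC subrr.
Qed.

Fact dual_unitPl x y : y * x = 1 -> dual_unit x.
Proof.
move=> /(congr1 (@rpart R)) yx1; rewrite /dual_unit; apply/eqP => x0.
move: yx1; rewrite -[LHS]/(rpart y * rpart x) x0 mulr0 => /esym/eqP.
by rewrite -[X in X == _]/(1 : R) oner_eq0.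
Qed.

Fact dual_invr_out : {in [predC dual_unit], dual_inv =1 id}.
Proof.
by move=> x; rewrite inE unfold_in negbK /dual_inv => ->.
Qed.

HB.instance Definition _ := GRing.ComNzRing_hasMulInverse.Build (dualnum R)
  dual_mulV dual_unitPl dual_invr_out.

End DualUnitRing.

Section DualAnalysis.
Variable R : realType.
Implicit Types (x c : dualnum R) (f : dualnum R -> dualnum R).

Definition dual_abs x : R := `|rpart x|.

(* Series of dual numbers converge, and are summed, in real and dual parts. *)
Definition dual_psum (u : nat -> dualnum R) (n : nat) : dualnum R :=
  \sum_(0 <= k < n) u k.

Definition dual_series_cvg (u : nat -> dualnum R) : Prop :=
  cvgn (fun n => rpart (dual_psum u n)) /\
  cvgn (fun n => dpart (dual_psum u n)).

Definition dual_series_sum (u : nat -> dualnum R) : dualnum R :=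
  DualNum (limn (fun n => rpart (dual_psum u n)))
          (limn (fun n => dpart (dual_psum u n))).

Definition dual_poch c (k : nat) : dualnum R := \prod_(j < k) (c + j%:R).

Definition dual_hyper_term (a b : seq (dualnum R)) x (k : nat) : dualnum R :=
  (\prod_(c <- a) dual_poch c k) / (\prod_(c <- b) dual_poch c k)
  * (x ^+ k / k`!%:R).

Definition dual_hyper (a b : seq (dualnum R)) x : dualnum R :=
  dual_series_sum (dual_hyper_term a b x).

(* d/dx is the partial derivative in x1, the dual part x2 being fixed. *)
Definition dual_derivable f x : Prop :=
  derivable (fun t : R => rpart (f (DualNum t (dpart x)))) (rpart x) 1 /\
  derivable (fun t : R => dpart (f (DualNum t (dpart x)))) (rpart x) 1.

Definition dual_derive f x : dualnum R :=
  DualNum (derive1 (fun t : R => rpart (f (DualNum t (dpart x)))) (rpart x))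
          (derive1 (fun t : R => dpart (f (DualNum t (dpart x)))) (rpart x)).

Definition dual_theta f x : dualnum R := x * dual_derive f x.

(* The operator theta + c, where the constant c acts by multiplication. *)
Definition dual_theta_add c f x : dualnum R := dual_theta f x + c * f x.

(* The composite (theta + c_1) o ... o (theta + c_n) for s = [c_1; ...; c_n]. *)
Definition dual_theta_prod (s : seq (dualnum R)) f : dualnum R -> dualnum R :=
  foldr dual_theta_add f s.

End DualAnalysis.

(* Main.v *)
Require Import Defs.
From HB Require Import structures.
From mathcomp Require Import all_boot all_order all_algebra.
From mathcomp Require Import all_classical all_reals all_analysis.
From mathcomp Require Import ring lra.

Set Implicit Arguments.
Unset Strict Implicit.
Unset Printing Implicit Defensive.

Import Order.TTheory GRing.Theory Num.Theory.
Import numFieldNormedType.Exports.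

Local Open Scope ring_scope.

(** Write c_k for the k-th coefficient of the hypergeometric series, a dual
number.  With A(k) the product of the a_i + k and B(k) the product of the
b_j + k, the coefficients satisfy (k + 1) B(k) c_(k+1) = A(k) c_k
([dual_hyper_coefS]).  The operator theta multiplies the coefficient of x^k by
k, so theta composed with the theta + b_j - 1 multiplies it by k B(k - 1), while
x times the composite of the theta + a_i sends c_k x^k to A(k) c_k x^(k+1).  The
two sides of the equation have the same coefficients ([dual_hyper_ode]).

The analytic content is that dual power series may be differentiated term by
term.  Because eps is nilpotent, the sum at x1 + eps x2 is
u(x1) + eps (v(x1) + x2 u'(x1)), where u and v are the real power series of the
real and dual parts of the coefficients ([dual_pseries_sum]); this reduces
differentiation in x1 to real power series.

Since the real parts of the c_k may vanish from some rank on while their dual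
parts do not, as when some Re(a_i) is a nonpositive integer, the ratio test is
not applied to real and dual parts separately.  It is applied to the norm
|x1| + |x2|, which is submultiplicative ([dual_normM]), and to the dual ratio
A(k) / ((k + 1) B(k)), which tends to 1 if p = q + 1 and to 0 if p <= q
([dual_cvg_prod_ratio]).  The information retained from the ratio test is that
|c_k| z^k is bounded for each 0 < z < K ([radius_ge]); this property passes to
the coefficients of theta and of derivatives of any order, and it gives the
convergence of all the series involved on the disk |x1| < K. *)

(** * Algebra of dual numbers *)

Lemma dual_eqP {R : Type} (x y : dualnum R) :
  rpart x = rpart y -> dpart x = dpart y -> x = y.
Proof. by case: x y => x1 x2 [y1 y2] /= -> ->. Qed.

Lemma dpartM {R : comNzRingType} (x y : dualnum R) :
  dpart (x * y) = rpart x * dpart y + dpart x * rpart y.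
Proof. by []. Qed.

Fact rpart_zmod_morphism (R : comNzRingType) :
  zmod_morphism (@rpart R : dualnum R -> R).
Proof. by []. Qed.

Fact rpart_monoid_morphism (R : comNzRingType) :
  monoid_morphism (@rpart R : dualnum R -> R).
Proof. by []. Qed.

Fact dpart_zmod_morphism (R : comNzRingType) :
  zmod_morphism (@dpart R : dualnum R -> R).
Proof. by []. Qed.

HB.instance Definition _ (R : comNzRingType) :=
  GRing.isZmodMorphism.Build (dualnum R) R (@rpart R) (@rpart_zmod_morphism R).
HB.instance Definition _ (R : comNzRingType) :=
  GRing.isMonoidMorphism.Build (dualnum R) R (@rpart R)
    (@rpart_monoid_morphism R).
HB.instance Definition _ (R : comNzRingType) :=
  GRing.isZmodMorphism.Build (dualnum R) R (@dpart R) (@dpart_zmod_morphism R).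

Lemma dpart_nat {R : comNzRingType} (n : nat) : dpart (n%:R : dualnum R) = 0.
Proof. by rewrite raddfMn; exact: mul0rn. Qed.

Lemma dpart_natM {R : comNzRingType} (n : nat) (x : dualnum R) :
  dpart (n%:R * x) = n%:R * dpart x.
Proof. by rewrite dpartM rmorph_nat dpart_nat mul0r addr0. Qed.

(** The Taylor expansion (x1 + eps x2)^n = x1^n + eps n x1^(n-1) x2, which is
exact because eps^2 = 0. *)
Lemma dpartX {R : comNzRingType} (x : dualnum R) (n : nat) :
  dpart (x ^+ n) = n%:R * rpart x ^+ n.-1 * dpart x.
Proof.
elim: n => [|n IHn]; first by rewrite !mul0r.
rewrite exprS dpartM IHn rmorphXn /=; case: n {IHn} => [|n] /=.
  by rewrite !mul0r mulr0 add0r !mulr1 mul1r.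
by rewrite exprS -[in RHS]natr1; ring.
Qed.

Lemma dual_unitE {R : fieldType} (x : dualnum R) :
  (x \is a GRing.unit) = (rpart x != 0).
Proof. by []. Qed.

Lemma dual_unit_nat {R : numFieldType} (n : nat) :
  ((n.+1)%:R : dualnum R) \is a GRing.unit.
Proof. by rewrite dual_unitE rmorph_nat pnatr_eq0. Qed.

Lemma dual_invE {R : fieldType} (x : dualnum R) : rpart x != 0 ->
  x^-1 = DualNum (rpart x)^-1 (- (dpart x / rpart x ^+ 2)).
Proof.
by move=> x0; rewrite -[LHS]/(dual_inv x) /dual_inv (negbTE x0).
Qed.

Lemma dual_unit_shift {R : fieldType} (b : dualnum R) (n : nat) :
  rpart b <> - n%:R -> b + n%:R \is a GRing.unit.
Proof.
by move=> hb; rewrite dual_unitE rmorphD rmorph_nat /= addr_eq0; apply/eqP.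
Qed.

Lemma dual_unit_prod_shift {R : fieldType} (b : seq (dualnum R)) (n : nat) :
  {in b, forall c, rpart c <> - n%:R} ->
  \prod_(c <- b) (c + n%:R) \is a GRing.unit.
Proof.
by move=> hb; rewrite big_seq rpred_prod // => c /hb; exact: dual_unit_shift.
Qed.

(** * A submultiplicative norm *)

Definition dual_norm {R : realType} (x : dualnum R) : R :=
  `|rpart x| + `|dpart x|.

Section DualNorm.
Context {R : realType}.
Implicit Types x y : dualnum R.

Lemma dual_norm_ge0 x : 0 <= dual_norm x.
Proof. by rewrite addr_ge0. Qed.

(** Expanded, the right-hand side has four terms; three bound the left-hand side by
the triangle inequality, and the fourth, |x2 y2|, belongs to eps^2 = 0. *)
Lemma dual_normM x y : dual_norm (x * y) <= dual_norm x * dual_norm y.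
Proof.
rewrite /dual_norm dpartM rmorphM /= normrM.
have := ler_normD (rpart x * dpart y) (dpart x * rpart y).
rewrite !normrM => h.
have := mulr_ge0 (normr_ge0 (dpart x)) (normr_ge0 (dpart y)); nra.
Qed.

Lemma dual_normD x y : dual_norm (x + y) <= dual_norm x + dual_norm y.
Proof.
by rewrite /dual_norm addrACA lerD // ?raddfD ler_normD.
Qed.

Lemma dual_norm_nat (n : nat) : dual_norm (n%:R : dualnum R) = n%:R.
Proof. by rewrite /dual_norm rmorph_nat dpart_nat normr0 addr0 normr_nat. Qed.

End DualNorm.

(** * Convergence of sequences of dual numbers *)

Definition dual_cvg {R : realType} (u : nat -> dualnum R) (l : dualnum R) :
    Prop :=
  ((fun n => rpart (u n)) @ \oo --> rpart l)%classic /\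
  ((fun n => dpart (u n)) @ \oo --> dpart l)%classic.

Section DualConvergence.
Local Open Scope classical_set_scope.
Local Open Scope ring_scope.
Context {R : realType}.
Implicit Types (u v : nat -> dualnum R) (l m c : dualnum R).

Lemma dual_cvg_cst c : dual_cvg (fun=> c) c.
Proof. by split; exact: cvg_cst. Qed.

Lemma dual_cvgD u v l m : dual_cvg u l -> dual_cvg v m ->
  dual_cvg (fun n => u n + v n) (l + m).
Proof. by move=> [u1 u2] [v1 v2]; split; exact: cvgD. Qed.

Lemma dual_cvgM u v l m : dual_cvg u l -> dual_cvg v m ->
  dual_cvg (fun n => u n * v n) (l * m).
Proof.
move=> [u1 u2] [v1 v2]; split; first exact: cvgM.
by apply: cvgD; exact: cvgM.
Qed.

Lemma dual_cvg_unique u l m : dual_cvg u l -> dual_cvg u m -> l = m.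
Proof.
move=> [u1 u2] [v1 v2]; apply: dual_eqP.
  exact: (cvg_unique _ u1 v1).
exact: (cvg_unique _ u2 v2).
Qed.

Lemma dual_cvg_norm u l : dual_cvg u l ->
  ((fun n => dual_norm (u n)) @ \oo --> dual_norm l)%classic.
Proof. by move=> [u1 u2]; apply: cvgD; exact: cvg_norm. Qed.

Lemma dual_cvg_shiftS u l :
  dual_cvg (fun n => u n.+1) l <-> dual_cvg u l.
Proof.
by rewrite /dual_cvg -(cvg_shiftS (fun n => rpart (u n)))
  -(cvg_shiftS (fun n => dpart (u n))).
Qed.

Lemma dual_cvg_inv_shift c :
  dual_cvg (fun n => (c + n%:R)^-1) 0.
Proof.
have cy : ((fun n : nat => rpart c + n%:R) @ \oo --> +oo%R)%classic.
  apply/cvgryPge => A; have /cvgryPge/(_ (A - rpart c)) := @cvgr_idn R.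
  by apply: filterS => n; rewrite lerBlDl.
have pos : \forall n \near \oo, 0 < rpart c + n%:R by exact: cvgry_gt.
have V0 : ((fun n : nat => (rpart c + n%:R)^-1) @ \oo --> (0 : R))%classic.
  by apply/gtr0_cvgV0.
(* The inverse has the explicit form below only from the rank on where the real
   part of c + n is nonzero. *)
have invE : \forall n \near \oo, DualNum (rpart c + n%:R)^-1
    (- (dpart c * ((rpart c + n%:R)^-1 * (rpart c + n%:R)^-1)))
    = (c + n%:R)^-1.
  near=> n.
  have n0 : rpart (c + n%:R) != 0.
    by rewrite rmorphD rmorph_nat gt_eqF //=; near: n.
  rewrite dual_invE // rmorphD rmorph_nat /= dpart_nat addr0.
  by rewrite expr2 invfM.
split; apply: cvg_trans.
- by apply: near_eq_cvg; apply: filterS invE => n <-.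
- exact: V0.
- by apply: near_eq_cvg; apply: filterS invE => n <-.
- rewrite /= -oppr0 -[X in - X](mulr0 (dpart c)) -[X in _ * X](mulr0 0).
  by apply: cvgN; apply: cvgM; [exact: cvg_cst|exact: cvgM].
Unshelve. all: by end_near.
Qed.

(** The ratio is 1 + (a - b) / (b + n). *)
Lemma dual_cvg_ratio_shift (a b : dualnum R) :
  (forall n : nat, rpart b <> - n%:R) ->
  dual_cvg (fun n => (a + n%:R) / (b + n%:R)) 1.
Proof.
move=> hb.
have -> : (fun n : nat => (a + n%:R) / (b + n%:R))
    = (fun n => 1 + (a - b) * (b + n%:R)^-1).
  apply/funext => n; have un := dual_unit_shift (hb n).
  have -> : a + n%:R = b + n%:R + (a - b) by ring.
  by rewrite mulrDl divrr.
have /(dual_cvgD (dual_cvg_cst 1)) :=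
  dual_cvgM (dual_cvg_cst (a - b)) (dual_cvg_inv_shift b).
by rewrite mulr0 addr0.
Qed.

(** Each upper factor is paired with a lower one, their quotient tending to 1;
any lower factor left over contributes an inverse tending to 0. *)
Lemma dual_cvg_prod_ratio (a b : seq (dualnum R)) :
  (size a <= size b)%N -> {in b, forall c (m : nat), rpart c <> - m%:R} ->
  dual_cvg (fun n => (\prod_(c <- a) (c + n%:R)) / \prod_(c <- b) (c + n%:R))
    (size a == size b)%:R.
Proof.
elim: b a => [|b0 b IHb] [|a0 a] //= sab hb.
- under eq_fun do rewrite !big_nil divr1.
  exact: dual_cvg_cst.
all: have hb0 := hb b0 (mem_head _ _).
all: have {}hb : {in b, forall c (m : nat), rpart c <> - m%:R}
  by move=> c cb; apply: hb; rewrite inE cb orbT.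
all: have ub n : \prod_(c <- b) (c + n%:R) \is a GRing.unit
  by apply: dual_unit_prod_shift => c cb; exact: hb.
all: have ub0 n := dual_unit_shift (hb0 n).
- have /(dual_cvgM (dual_cvg_inv_shift b0)) := IHb [::] isT hb; rewrite mul0r.
  congr dual_cvg; apply/funext => n.
  by rewrite !big_nil big_cons !mul1r invrM // mulrC.
- have /(dual_cvgM (dual_cvg_ratio_shift a0 hb0)) := IHb a sab hb.
  rewrite mul1r eqSS; congr dual_cvg; apply/funext => n.
  by rewrite !big_cons invrM //; ring.
Qed.

End DualConvergence.

(** * Coefficient sequences and their radius of convergence *)

(** Boundedness of the terms on each smaller disk says that the power series of
coefficients [c] has radius of convergence at least [K], and is easier to
transport than convergence. *)
Definition radius_ge {R : realType} (K : R) (c : nat -> dualnum R) : Prop :=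
  forall z, 0 < z -> z < K ->
  exists M, forall k, dual_norm (c k) * z ^+ k <= M.

Definition dual_diffs {R : realType} (c : nat -> dualnum R) (k : nat) :
    dualnum R :=
  k.+1%:R * c k.+1.

Section Radius.
Local Open Scope classical_set_scope.
Local Open Scope ring_scope.
Context {R : realType}.
Implicit Types (c rho : nat -> dualnum R) (d l : dualnum R) (K : R).

(** Ratio test: the terms |c_k| z^k are eventually nonincreasing. *)
Lemma radius_ge_ratio K c rho l :
  (forall k, c k.+1 = rho k * c k) -> dual_cvg rho l ->
  (forall z, 0 < z -> z < K -> dual_norm l * z < 1) -> radius_ge K c.
Proof.
move=> crec rhol lK z z0 zK.
have [N _ hN] : \forall n \near \oo, dual_norm (rho n) < z^-1.
  by apply: (cvgr_lt _ (dual_cvg_norm rhol)); rewrite -[ltRHS]mul1r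
    ltr_pdivlMr // lK.
pose t k := dual_norm (c k) * z ^+ k.
have t0 k : 0 <= t k by rewrite mulr_ge0 ?dual_norm_ge0 ?exprn_ge0 // ltW.
have tN k : t (N + k)%N <= t N.
  elim: k => [|k IHk]; first by rewrite addn0.
  apply: le_trans IHk; rewrite /t addnS crec exprS mulrA.
  rewrite ler_wpM2r ?exprn_ge0 ?(ltW z0) //.
  rewrite -ler_pdivlMr // [_ / z]mulrC (le_trans (dual_normM _ _)) //.
  by rewrite ler_wpM2r ?dual_norm_ge0 // ltW // hN //= leq_addr.
exists (\sum_(i < N.+1) t i) => k; rewrite -/(t k).
have le_sum (i : nat) : (i <= N)%N -> t i <= \sum_(i < N.+1) t i.
  move=> iN; rewrite (bigD1 (Ordinal (iN : (i < N.+1)%N))) //=.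
  by rewrite lerDl sumr_ge0.
have [kN|/ltnW Nk] := leqP k N; first exact: le_sum.
by rewrite -(subnKC Nk) (le_trans (tN _)) // le_sum.
Qed.

(** The constant C = (1 - z / w)^-1 works for all k at once: with e = C^-1, the
identity e w = w - z makes the induction step exact. *)
Lemma natS_geometric_bound (z w : R) : 0 < z -> z < w ->
  exists C, forall k, k.+1%:R * z ^+ k <= C * w ^+ k.
Proof.
move=> z0 zw; pose e := 1 - z / w.
have w0 : 0 < w by exact: lt_trans zw.
have e0 : 0 < e by rewrite subr_gt0 ltr_pdivrMr // mul1r.
have ew : e * w = w - z by rewrite mulrBl mul1r divfK // gt_eqF.
exists e^-1 => k; rewrite ler_pdivlMl //.
elim: k => [|k IHk].
  by rewrite !expr0 !mulr1 lerBlDr lerDl ltW // divr_gt0.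
have -> : w ^+ k.+1 = z * w ^+ k + e * w * w ^+ k by rewrite ew exprS; ring.
have -> : e * (k.+2%:R * z ^+ k.+1)
    = z * (e * (k.+1%:R * z ^+ k)) + e * z ^+ k.+1.
  by rewrite exprS -[k.+2%:R]natr1; ring.
by rewrite -mulrA -exprS lerD ?ler_wpM2l ?lerXn2r // ?nnegrE ltW.
Qed.

Lemma radius_ge_shift K c : radius_ge K c -> radius_ge K (fun k => c k.+1).
Proof.
move=> cK z z0 zK; have [M hM] := cK z z0 zK; exists (M / z) => k.
by rewrite ler_pdivlMr // -mulrA -exprSr.
Qed.

(** Passing from z to a larger w < K absorbs the linear growth of d + k. *)
Lemma radius_ge_natM K c d : radius_ge K c ->
  radius_ge K (fun k => (d + k%:R) * c k).
Proof.
move=> cK z z0 zK; pose w := (z + K) / 2.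
have zw : z < w by rewrite /w; lra.
have wK : w < K by rewrite /w; lra.
have w0 := lt_trans z0 zw.
have [M hM] := cK w w0 wK; have [C hC] := natS_geometric_bound z0 zw.
exists ((dual_norm d + 1) * C * M) => k.
have kle : dual_norm (d + k%:R) <= (dual_norm d + 1) * k.+1%:R.
  rewrite (le_trans (dual_normD _ _)) // dual_norm_nat -natr1.
  have := dual_norm_ge0 d; have := ler0n R k; nra.
have zk0 : 0 <= z ^+ k by rewrite exprn_ge0 ?ltW.
have wk0 : 0 < w ^+ k by rewrite exprn_gt0.
have C0 : 0 <= C.
  by rewrite -(pmulr_lge0 _ wk0) (le_trans _ (hC k)) // mulr_ge0.
have d1 : 0 <= dual_norm d + 1 by rewrite addr_ge0 ?dual_norm_ge0.
apply: (@le_trans _ _ ((dual_norm d + 1) * k.+1%:R * dual_norm (c k) * z ^+ k)).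
  rewrite ler_wpM2r // (le_trans (dual_normM _ _)) //.
  by rewrite ler_wpM2r ?dual_norm_ge0.
apply: (@le_trans _ _ ((dual_norm d + 1) * (C * w ^+ k) * dual_norm (c k))).
  rewrite mulrAC ler_wpM2r ?dual_norm_ge0 // -mulrA ler_wpM2l //.
rewrite !mulrA -mulrA [_ * dual_norm _]mulrC ler_wpM2l //.
by rewrite mulr_ge0.
Qed.

Lemma radius_ge_diffs K c : radius_ge K c -> radius_ge K (dual_diffs c).
Proof.
move=> cK; have /radius_ge_shift := radius_ge_natM 0 cK.
by congr radius_ge; apply/funext => k; rewrite add0r.
Qed.

(** Comparison with a geometric series of ratio |s| / z, where |s| < z < K. *)
Lemma bounded_cvg_pseries K (f : nat -> R) (s : R) :
  (forall z, 0 < z -> z < K -> exists M, forall k, `|f k| * z ^+ k <= M) ->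
  `|s| < K -> cvgn (pseries f s).
Proof.
move=> fK sK; pose z := (`|s| + K) / 2.
have s0 := normr_ge0 s.
have z0 : 0 < z by rewrite /z; lra.
have zK : z < K by rewrite /z; lra.
have sz : `|s| < z by rewrite /z; lra.
have [M hM] := fK z z0 zK.
have M0 : 0 <= M by rewrite (le_trans _ (hM 0)) // expr0 mulr1.
apply: normed_cvg; rewrite /normed_series_of /=.
apply: (series_le_cvg (v_ := geometric M (`|s| / z))) => [n||n|] /=.
- exact: normr_ge0.
- by move=> n; rewrite mulr_ge0 // exprn_ge0 // divr_ge0 // ltW.
- rewrite normrM normrX expr_div_n mulrCA mulrC ler_wpM2l ?exprn_ge0 //.
  by rewrite ler_pdivlMr ?exprn_gt0.
- apply: is_cvg_geometric_series.
  by rewrite normrM normr_id normfV (gtr0_norm z0) ltr_pdivrMr // mul1r.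
Qed.

Lemma radius_ge_cvg K c (s : R) : radius_ge K c -> `|s| < K ->
  cvgn (pseries (fun k => rpart (c k)) s) /\
  cvgn (pseries (fun k => dpart (c k)) s).
Proof.
move=> cK sK; split; apply: bounded_cvg_pseries sK => z z0 zK;
  have [M hM] := cK z z0 zK; exists M => k; apply: le_trans (hM k);
  rewrite ler_wpM2r ?exprn_ge0 ?(ltW z0) //.
- by rewrite lerDl.
- by rewrite lerDr.
Qed.

Lemma rpart_diffs c :
  (fun k => rpart (dual_diffs c k)) = pseries_diffs (fun k => rpart (c k)).
Proof. by apply/funext => k; rewrite rmorphM rmorph_nat. Qed.

Lemma dpart_diffs c :
  (fun k => dpart (dual_diffs c k)) = pseries_diffs (fun k => dpart (c k)).
Proof. by apply/funext => k; rewrite dpart_natM. Qed.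

Lemma radius_ge_is_derive K c (s : R) : radius_ge K c -> `|s| < K ->
  is_derive s 1 (fun t => limn (pseries (fun k => rpart (c k)) t))
    (limn (pseries (fun k => rpart (dual_diffs c k)) s)) /\
  is_derive s 1 (fun t => limn (pseries (fun k => dpart (c k)) t))
    (limn (pseries (fun k => dpart (dual_diffs c k)) s)).
Proof.
move=> cK sK; pose z := (`|s| + K) / 2.
have s0 := normr_ge0 s.
have z0 : 0 <= z by rewrite /z; lra.
have zK : `|z| < K by rewrite ger0_norm // /z; lra.
have sz : `|s| < `|z| by rewrite [ltRHS]ger0_norm // /z; lra.
have c1K := radius_ge_diffs cK; have c2K := radius_ge_diffs c1K.
have [r0 d0] := radius_ge_cvg cK zK.
have [] := radius_ge_cvg c2K zK.
have [] := radius_ge_cvg c1K zK.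
rewrite !(rpart_diffs, dpart_diffs) => r1 d1 r2 d2.
by split; exact: pseries_snd_diffs sz.
Qed.

End Radius.

(** * Sums of dual series *)

(** The value of a dual power series at x1 + eps x2 expanded in the nilpotent
direction, u(x1) + eps (v(x1) + x2 u'(x1)). *)
Definition dual_pseries {R : realType} (c : nat -> dualnum R) (x : dualnum R) :
    dualnum R :=
  DualNum (limn (pseries (fun k => rpart (c k)) (rpart x)))
    (limn (pseries (fun k => dpart (c k)) (rpart x))
     + dpart x * limn (pseries (fun k => rpart (dual_diffs c k)) (rpart x))).

Section DualSeries.
Context {R : realType}.
Implicit Types (u v c : nat -> dualnum R) (x d S T : dualnum R).

Lemma dual_sumD u v S T :
  dual_cvg (dual_psum u) S -> dual_cvg (dual_psum v) T ->
  dual_cvg (dual_psum (fun k => u k + v k)) (S + T).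
Proof.
move=> /dual_cvgD h /h; congr dual_cvg; apply/funext => n.
by rewrite /dual_psum big_split.
Qed.

Lemma dual_sumZ u S d : dual_cvg (dual_psum u) S ->
  dual_cvg (dual_psum (fun k => d * u k)) (d * S).
Proof.
move=> /(dual_cvgM (dual_cvg_cst d)); congr dual_cvg; apply/funext => n.
by rewrite /dual_psum mulr_sumr.
Qed.

Lemma dual_sum_shift u S : u 0%N = 0 ->
  dual_cvg (dual_psum (fun k => u k.+1)) S -> dual_cvg (dual_psum u) S.
Proof.
move=> u0 uS; rewrite -dual_cvg_shiftS; move: uS.
congr dual_cvg; apply/funext => n.
by rewrite /dual_psum [RHS]big_nat_recl // u0 add0r.
Qed.

Lemma dual_sum_series u S : dual_cvg (dual_psum u) S ->
  dual_series_cvg u /\ dual_series_sum u = S.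
Proof.
move=> [rS dS]; split; first by split; [apply: cvgP rS|apply: cvgP dS].
by apply: dual_eqP; [exact: (cvg_lim _ rS)|exact: (cvg_lim _ dS)].
Qed.

Lemma dual_pseries_sum K c x : radius_ge K c -> `|rpart x| < K ->
  dual_cvg (dual_psum (fun k => c k * x ^+ k))
    (dual_pseries c x).
Proof.
move=> cK xK; have [r0 d0] := radius_ge_cvg cK xK.
have [r1 _] := radius_ge_cvg (radius_ge_diffs cK) xK.
rewrite rpart_diffs in r1; rewrite /dual_pseries rpart_diffs; split.
  apply: cvg_trans r0; apply: near_eq_cvg; near=> n.
  rewrite /pseries /series /= /dual_psum rmorph_sum.
  by apply: eq_bigr => k _; rewrite rmorphM rmorphXn.
have /(cvgM (cvg_cst (dpart x)))/(cvgD d0) := pseries_diffs_equiv r1.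
apply: cvg_trans; apply: near_eq_cvg; near=> n.
rewrite -[LHS]/(pseries _ _ n + dpart x * series _ n).
rewrite /pseries /series /= /dual_psum raddf_sum mulr_sumr -big_split.
by apply: eq_bigr => k _; rewrite [RHS]dpartM dpartX rmorphXn /=; ring.
Unshelve. all: by end_near.
Qed.

End DualSeries.

(** * Differential operators on power series expansions *)

Definition dual_expands {R : realType} (K : R) (c : nat -> dualnum R)
    (f : dualnum R -> dualnum R) : Prop :=
  radius_ge K c /\
  forall x, `|rpart x| < K ->
    dual_cvg (dual_psum (fun k => c k * x ^+ k)) (f x).

Section Operators.
Local Open Scope classical_set_scope.
Local Open Scope ring_scope.
Context {R : realType}.
Implicit Types (K : R) (c : nat -> dualnum R) (x d : dualnum R)
  (f : dualnum R -> dualnum R) (s : seq (dualnum R)).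

Lemma dual_expandsE K c f x : dual_expands K c f -> `|rpart x| < K ->
  f x = dual_pseries c x.
Proof.
move=> [cK cf] xK; apply: dual_cvg_unique (cf x xK) _.
exact: dual_pseries_sum cK xK.
Qed.

(** The expansion holds on a whole disk, hence in a neighbourhood of the real
part of [x]; there the two parts of [f] are those of [dual_pseries]. *)
Lemma dual_expands_is_derive K c f x :
  dual_expands K c f -> `|rpart x| < K ->
  is_derive (rpart x) 1 (fun t => rpart (f (DualNum t (dpart x))))
    (limn (pseries (fun k => rpart (dual_diffs c k)) (rpart x))) /\
  is_derive (rpart x) 1 (fun t => dpart (f (DualNum t (dpart x))))
    (limn (pseries (fun k => dpart (dual_diffs c k)) (rpart x))
     + dpart x *
       limn (pseries (fun k => rpart (dual_diffs (dual_diffs c) k)) (rpart x))).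
Proof.
move=> cf xK; have [cK _] := cf.
have [dr dd] := radius_ge_is_derive cK xK.
have [dr1 _] := radius_ge_is_derive (radius_ge_diffs cK) xK.
have nearK : \forall t \near rpart x, `|t| < K.
  exact: (cvgr_lt _ (cvg_norm (@cvg_id _ (nbhs (rpart x))))).
split.
  apply: near_eq_is_derive dr; apply: filterS nearK => t tK.
  by rewrite (dual_expandsE cf).
have dd1 := is_deriveD dd (is_deriveZ (dpart x) dr1).
apply: near_eq_is_derive dd1; apply: filterS nearK => t tK.
by rewrite (dual_expandsE cf).
Qed.

Lemma dual_expands_derivable K c f x :
  dual_expands K c f -> `|rpart x| < K -> dual_derivable f x.
Proof.
move=> cf xK; have [dr dd] := dual_expands_is_derive cf xK.
by split; apply: ex_derive.
Qed.

Lemma dual_expands_derive K c f :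
  dual_expands K c f -> dual_expands K (dual_diffs c) (dual_derive f).
Proof.
move=> cf; have [cK _] := cf; have c1K := radius_ge_diffs cK.
split=> // x xK; have [dr dd] := dual_expands_is_derive cf xK.
have := dual_pseries_sum c1K xK; congr (dual_cvg _ _).
by rewrite /dual_pseries /dual_derive !derive1E !derive_val.
Qed.

Lemma dual_expands_derive_iter K c f n :
  dual_expands K c f ->
  dual_expands K (iter n dual_diffs c) (iter n (@dual_derive R) f).
Proof. by move=> cf; elim: n => //= n; exact: dual_expands_derive. Qed.

(** Multiplication by [x] shifts the coefficients of the derivative back by one
place; the vacant constant term is filled by 0 = 0 * c_0. *)
Lemma dual_expands_theta K c f : dual_expands K c f ->
  dual_expands K (fun k => k%:R * c k) (dual_theta f).
Proof.
move=> cf; have [cK _] := cf; split.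
  have := radius_ge_natM 0 cK.
  by congr radius_ge; apply/funext => k; rewrite add0r.
move=> x xK; have [_ /(_ x xK)] := dual_expands_derive cf.
move=> /(dual_sumZ x) h; apply: dual_sum_shift; first by rewrite !mul0r.
move: h; congr dual_cvg; congr dual_psum; apply/funext => k.
by rewrite /dual_diffs exprS; ring.
Qed.

Lemma dual_expands_theta_add K c d f : dual_expands K c f ->
  dual_expands K (fun k => (d + k%:R) * c k) (dual_theta_add d f).
Proof.
move=> cf; have [cK cfE] := cf; split; first exact: radius_ge_natM.
move=> x xK; have [_ /(_ x xK) hth] := dual_expands_theta cf.
have := dual_sumD hth (dual_sumZ d (cfE x xK)).
congr dual_cvg; congr dual_psum; apply/funext => k; ring.
Qed.

Lemma dual_expands_theta_prod K c s f : dual_expands K c f ->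
  dual_expands K (fun k => (\prod_(d <- s) (d + k%:R)) * c k)
    (dual_theta_prod s f).
Proof.
move=> cf; elim: s => [|d s IHs].
  by under eq_fun do rewrite big_nil mul1r.
have := dual_expands_theta_add d IHs.
by congr dual_expands; apply/funext => k; rewrite big_cons mulrA.
Qed.

End Operators.

(** * The hypergeometric series *)

Definition dual_hyper_coef {R : realType} (a b : seq (dualnum R)) (k : nat) :
    dualnum R :=
  (\prod_(c <- a) dual_poch c k) / (\prod_(c <- b) dual_poch c k) / k`!%:R.

Section Hypergeometric.
Context {R : realType}.
Implicit Types (a b : seq (dualnum R)) (x c : dualnum R).

Definition regular_params b : Prop :=
  {in b, forall c (m : nat), rpart c <> - m%:R}.

Lemma dual_hyper_termE a b x :
  dual_hyper_term a b x = (fun k => dual_hyper_coef a b k * x ^+ k).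
Proof.
by apply/funext => k; rewrite /dual_hyper_term /dual_hyper_coef mulrCA mulrC.
Qed.

Lemma dual_pochS c k : dual_poch c k.+1 = dual_poch c k * (c + k%:R).
Proof. by rewrite /dual_poch big_ord_recr. Qed.

Lemma dual_prod_pochS a k : \prod_(c <- a) dual_poch c k.+1
  = (\prod_(c <- a) dual_poch c k) * \prod_(c <- a) (c + k%:R).
Proof. by rewrite -big_split; apply: eq_bigr => c _; rewrite dual_pochS. Qed.

Lemma dual_unit_prod_poch b k : regular_params b ->
  \prod_(c <- b) dual_poch c k \is a GRing.unit.
Proof.
move=> hb; elim: k => [|k IHk].
  by rewrite big1 ?unitr1 // => c _; rewrite /dual_poch big_ord0.
by rewrite dual_prod_pochS unitrM IHk dual_unit_prod_shift // => c /hb.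
Qed.

Lemma dual_hyper_coefS a b k : regular_params b ->
  k.+1%:R * (\prod_(c <- b) (c + k%:R)) * dual_hyper_coef a b k.+1
  = (\prod_(c <- a) (c + k%:R)) * dual_hyper_coef a b k.
Proof.
move=> hb; have uB := dual_unit_prod_poch k hb.
have uS : \prod_(c <- b) (c + k%:R) \is a GRing.unit.
  by apply: dual_unit_prod_shift => c /hb.
have uk := dual_unit_nat (R := R) k.
have uf : (k`!%:R : dualnum R) \is a GRing.unit.
  by rewrite -[k`!]prednK ?fact_gt0 // dual_unit_nat.
rewrite /dual_hyper_coef !dual_prod_pochS factS natrM !invrM //.
set B := \prod_(c <- b) (c + k%:R) in uS *; set A := \prod_(c <- a) (c + _).
set P := \prod_(c <- a) _; set Q := (\prod_(c <- b) dual_poch _ _)^-1.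
transitivity (A * (P * Q / k`!%:R) * (k.+1%:R / k.+1%:R) * (B / B)); first ring.
by rewrite !divrr // !mulr1.
Qed.

(** The factor k + 1 is the shifted factor of one more lower parameter, equal to
1. *)
Lemma dual_hyper_coef_ratio a b k : regular_params b ->
  dual_hyper_coef a b k.+1 = (\prod_(c <- a) (c + k%:R)) /
    (\prod_(c <- 1 :: b) (c + k%:R)) * dual_hyper_coef a b k.
Proof.
move=> hb; have uS : k.+1%:R * \prod_(c <- b) (c + k%:R) \is a GRing.unit.
  by rewrite unitrM dual_unit_nat dual_unit_prod_shift // => c /hb.
rewrite big_cons nat1r mulrAC -dual_hyper_coefS // mulrC mulKr //.
Qed.

Lemma dual_hyper_radius K a b : (size a <= (size b).+1)%N -> regular_params b ->
  (size a = (size b).+1 -> K <= 1) -> radius_ge K (dual_hyper_coef a b).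
Proof.
move=> sab hb hK.
apply: (radius_ge_ratio (fun k => dual_hyper_coef_ratio a k hb)).
  apply: dual_cvg_prod_ratio => // c; rewrite inE => /predU1P[->|/hb//] m.
  by apply/eqP; rewrite -addr_eq0 nat1r pnatr_eq0.
move=> z z0 zK; rewrite dual_norm_nat /=.
have [/hK K1|_] := eqVneq; last by rewrite mul0r.
by rewrite mul1r (lt_le_trans zK).
Qed.

Lemma dual_hyper_expands K a b :
  (size a <= (size b).+1)%N -> regular_params b ->
  (size a = (size b).+1 -> K <= 1) ->
  dual_expands K (dual_hyper_coef a b) (dual_hyper a b).
Proof.
move=> sab hb hK; have cK := dual_hyper_radius sab hb hK; split=> // x xK.
have h := dual_pseries_sum cK xK; rewrite /dual_hyper dual_hyper_termE.
by have [_ ->] := dual_sum_series h.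
Qed.

(** Both sides have the coefficient A(k) c_k at x^(k+1), by the recurrence, and
no constant term. *)
Lemma dual_hyper_ode K a b x : (size a <= (size b).+1)%N -> regular_params b ->
  (size a = (size b).+1 -> K <= 1) -> `|rpart x| < K ->
  dual_theta (dual_theta_prod [seq c - 1 | c <- b] (dual_hyper a b)) x
  = x * dual_theta_prod a (dual_hyper a b) x.
Proof.
move=> sab hb hK xK; have ef := dual_hyper_expands sab hb hK.
have [_ /(_ x xK) hl] :=
  dual_expands_theta (dual_expands_theta_prod [seq c - 1 | c <- b] ef).
have [_ /(_ x xK)/(dual_sumZ x) hr] := dual_expands_theta_prod a ef.
apply: dual_cvg_unique hl _; apply: dual_sum_shift; first by rewrite !mul0r.
move: hr; congr dual_cvg; congr dual_psum; apply/funext => k.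
rewrite big_map; under [in RHS]eq_bigr do rewrite -nat1r addrA subrK.
by rewrite mulrCA -exprS [in RHS]mulrA dual_hyper_coefS // !mulrA.
Qed.

End Hypergeometric.

Theorem mainTheorem7 (R : realType) (p q : nat)
    (a : p.-tuple (dualnum R)) (b : q.-tuple (dualnum R)) (x : dualnum R)
    (hpq : (p <= q.+1)%N)
    (hb : forall (j : 'I_q) (m : nat), rpart (tnth b j) <> - m%:R)
    (hx : p = q.+1 -> dual_abs x < 1) :
  (* the series converges and its sum can be differentiated to any order *)
  dual_series_cvg (dual_hyper_term a b x) /\
  (forall n : nat,
     dual_derivable (iter n (@dual_derive R) (dual_hyper a b)) x) /\
  dual_theta (dual_theta_prod [seq c - 1 | c <- b] (dual_hyper a b)) x
  - x * dual_theta_prod a (dual_hyper a b) x = 0.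
Proof.
have hb' : regular_params b by move=> c /tnthP[j ->] m; exact: hb.
have sab : (size a <= (size b).+1)%N by rewrite !size_tuple.
(* For p <= q the radius is infinite, and any disk containing [x] will do. *)
pose K : R := if p == q.+1 then 1 else `|rpart x| + 1.
have hK : size a = (size b).+1 -> K <= 1.
  by rewrite !size_tuple /K => ->; rewrite eqxx.
have xK : `|rpart x| < K.
  by rewrite /K; case: eqP => [/hx//|_]; rewrite ltrDl.
have ef := dual_hyper_expands sab hb' hK.
split.
  have [_ /(_ x xK)/dual_sum_series[+ _]] := ef.
  by rewrite dual_hyper_termE.
split=> [n|].
  exact: dual_expands_derivable (dual_expands_derive_iter n ef) xK.
by rewrite (dual_hyper_ode sab hb' hK xK) subrr.
Qed.
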